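(* Let $a$ be a real number with $0<a<1$, and let $\alpha$ be a badly approximable real number, i.e. $\inf_{q\ge1} q\,\|q\alpha\|>0$. Then the set of real numbers $\beta$ such that $$\liminf_{q\to+\infty}\, q\,(\log q)^{2-a}\,\bigl(\log (1/\|q\alpha\|)\bigr)^a\,\|q\alpha\|\,\|q\beta\|>0$$ (where $q$ runs over positive integers) has Hausdorff dimension $1$.
   Context: For a real number $x$, $\|x\|$ denotes the distance from $x$ to the nearest integer. *)

(* Defs.v *)
From Stdlib Require Import Reals.
Open Scope R_scope.

Definition dnint (x : R) : R := Rmin (frac_part x) (1 - frac_part x).

Definition badly_approximable (alpha : R) : Prop :=
  exists c : R, 0 < c /\
    forall q : nat, (1 <= q)%nat -> c <= INR q * dnint (INR q * alpha).

(* d^s for real s > 0, with the convention 0^s = 0. *)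
Definition rpow (d s : R) : R :=
  if Rle_dec d 0 then 0 else Rpower d s.

Definition cover_sum_le (E : R -> Prop) (s delta M : R) : Prop :=
  exists (U : nat -> R -> Prop) (d : nat -> R),
    (forall i, 0 <= d i <= delta) /\
    (forall i x y, U i x -> U i y -> Rabs (x - y) <= d i) /\
    (forall x, E x -> exists i, U i x) /\
    (forall n, sum_f_R0 (fun i => rpow (d i) s) n <= M).

(* s-dimensional Hausdorff measure of E is zero:
   H^s(E) = sup_{delta>0} H^s_delta(E) = 0, i.e. every H^s_delta(E) = 0. *)
Definition hausdorff_null (s : R) (E : R -> Prop) : Prop :=
  forall delta eps, 0 < delta -> 0 < eps -> cover_sum_le E s delta eps.

Definition is_glb (P : R -> Prop) (m : R) : Prop :=
  (forall s, P s -> m <= s) /\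
  (forall b, (forall s, P s -> b <= s) -> b <= m).

Definition hausdorff_dim (E : R -> Prop) (dim : R) : Prop :=
  is_glb (fun s => 0 < s /\ hausdorff_null s E) dim.

Definition term (a alpha beta : R) (q : nat) : R :=
  INR q * Rpower (ln (INR q)) (2 - a)
        * Rpower (ln (1 / dnint (INR q * alpha))) a
        * dnint (INR q * alpha) * dnint (INR q * beta).

Definition liminf_pos (u : nat -> R) : Prop :=
  exists c : R, 0 < c /\ exists N : nat, forall q : nat, (N <= q)%nat -> c <= u q.

(* Main.v *)
Require Import Defs.
From Stdlib Require Import Reals ZArith Lra Lia Classical ClassicalEpsilon Wf_nat.
Open Scope R_scope.

(** For [s < 1] a hypothetical cover [U_i] of the set by sets of small total [s]-size is
    defeated by exhibiting a point of the set outside all [U_i], with a Peres-Schlag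
    counting argument on the tree of 8-adic boxes of [0, 1).  At level [k] delete the boxes
    that meet [|q x - p| < c / weight q] for some [q] in [2^k, 2^(k+1)), and those that meet
    an enlarged [U_i] of diameter about [8^-k].

    Since [alpha] is badly approximable, the values [||q alpha||] of the block are separated
    by a constant times [2^-k], whence the sum of [1 / weight q] over the block is [O(1/k)].
    The fractions [p/q] are equidistributed inside the boxes of level [k/3] (side at least
    [2^-k]), so the first deletion costs at most a proportion [1/(16k)] of the boxes lying
    over level [k/3], and the second one at most [8^k / (8k^2)] boxes because [s < 1].  The
    proportion [M_k] of surviving boxes thus satisfies
    [M_k >= M_(k-1) - M_(k/3) / (16k) - 1 / (8k^2)], which forces [M_k >= 1 / (k+1)]. *)

(** * Finite sums and counting *)

Fixpoint rsum (f : nat -> R) (n : nat) : R :=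
  match n with O => 0 | S m => rsum f m + f m end.

Definition ind (P : Prop) : R := if excluded_middle_informative P then 1 else 0.

Definition cnt (P : nat -> Prop) (n : nat) : R := rsum (fun i => ind (P i)) n.

Lemma ind_true (P : Prop) : P -> ind P = 1.
Proof. unfold ind; destruct (excluded_middle_informative P); tauto. Qed.

Lemma ind_false (P : Prop) : ~ P -> ind P = 0.
Proof. unfold ind; destruct (excluded_middle_informative P); tauto. Qed.

Lemma ind_bound (P : Prop) : 0 <= ind P <= 1.
Proof. unfold ind; destruct (excluded_middle_informative P); lra. Qed.

Lemma rsum_le (f g : nat -> R) (n : nat) :
  (forall i, (i < n)%nat -> f i <= g i) -> rsum f n <= rsum g n.
Proof.
  induction n as [|n IH]; simpl; intros H; [lra|].
  apply Rplus_le_compat; [apply IH; intros; apply H; lia | apply H; lia].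
Qed.

Lemma rsum_nonneg (f : nat -> R) (n : nat) :
  (forall i, (i < n)%nat -> 0 <= f i) -> 0 <= rsum f n.
Proof.
  induction n as [|n IH]; simpl; intros H; [lra|].
  apply Rplus_le_le_0_compat; [apply IH; intros; apply H; lia | apply H; lia].
Qed.

Lemma rsum_plus (f g : nat -> R) (n : nat) :
  rsum (fun i => f i + g i) n = rsum f n + rsum g n.
Proof. induction n as [|n IH]; simpl; [|rewrite IH]; lra. Qed.

Lemma rsum_scal (c : R) (f : nat -> R) (n : nat) :
  rsum (fun i => c * f i) n = c * rsum f n.
Proof. induction n as [|n IH]; simpl; [|rewrite IH]; lra. Qed.

Lemma rsum_const (c : R) (n : nat) : rsum (fun _ => c) n = INR n * c.
Proof. induction n as [|n IH]; [simpl; lra|]. rewrite S_INR; simpl; rewrite IH; lra. Qed.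

Lemma rsum_swap (f : nat -> nat -> R) (m n : nat) :
  rsum (fun i => rsum (f i) n) m = rsum (fun j => rsum (fun i => f i j) m) n.
Proof.
  induction m as [|m IH]; simpl.
  - rewrite rsum_const; lra.
  - rewrite IH, <- rsum_plus; reflexivity.
Qed.

Lemma rsum_term_le (f : nat -> R) (n i : nat) :
  (forall j, (j < n)%nat -> 0 <= f j) -> (i < n)%nat -> f i <= rsum f n.
Proof.
  induction n as [|n IH]; intros H Hi; [lia|]. simpl.
  assert (0 <= rsum f n) by (apply rsum_nonneg; intros; apply H; lia).
  assert (0 <= f n) by (apply H; lia).
  destruct (Nat.eq_dec i n) as [->|Hn]; [lra|].
  assert (f i <= rsum f n) by (apply IH; [intros; apply H|]; lia). lra.
Qed.

Lemma rsum_sum_f_R0 (f : nat -> R) (n : nat) : rsum f (S n) = sum_f_R0 f n.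
Proof.
  induction n as [|n IH]; [simpl; lra|].
  change (rsum f (S n) + f (S n) = sum_f_R0 f n + f (S n)). now rewrite IH.
Qed.

Lemma cnt_nonneg (P : nat -> Prop) (n : nat) : 0 <= cnt P n.
Proof. apply rsum_nonneg; intros; apply ind_bound. Qed.

Lemma cnt_union (P : nat -> Prop) (Q : nat -> nat -> Prop) (N n : nat) :
  (forall v, (v < N)%nat -> P v -> exists i, (i < n)%nat /\ Q i v) ->
  cnt P N <= rsum (fun i => cnt (Q i) N) n.
Proof.
  intros H. unfold cnt. rewrite rsum_swap. apply rsum_le; intros v Hv.
  destruct (classic (P v)) as [HP|HP].
  - destruct (H v Hv HP) as [i [Hi HQ]].
    rewrite (ind_true _ HP), <- (ind_true _ HQ).
    apply (rsum_term_le (fun i => ind (Q i v))); [intros; apply ind_bound | exact Hi].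
  - rewrite (ind_false _ HP). apply rsum_nonneg; intros; apply ind_bound.
Qed.

Lemma cnt_le (P Q : nat -> Prop) (n : nat) :
  (forall v, (v < n)%nat -> P v -> Q v) -> cnt P n <= cnt Q n.
Proof.
  intros H. apply rsum_le; intros v Hv.
  destruct (classic (P v)) as [HP|HP].
  - rewrite (ind_true _ HP), (ind_true _ (H v Hv HP)); lra.
  - rewrite (ind_false _ HP); apply ind_bound.
Qed.

Lemma cnt_or (P Q S : nat -> Prop) (n : nat) :
  (forall v, (v < n)%nat -> P v -> Q v \/ S v) -> cnt P n <= cnt Q n + cnt S n.
Proof.
  intros H. unfold cnt; rewrite <- rsum_plus. apply rsum_le; intros v Hv.
  pose proof (ind_bound (Q v)); pose proof (ind_bound (S v)).
  destruct (classic (P v)) as [HP|HP]; [|rewrite (ind_false _ HP); lra].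
  pose proof (ind_bound (P v)).
  destruct (H v Hv HP) as [HQ|HS]; [rewrite (ind_true _ HQ)|rewrite (ind_true _ HS)]; lra.
Qed.

Lemma cnt_empty (P : nat -> Prop) (n : nat) :
  (forall v, (v < n)%nat -> ~ P v) -> cnt P n = 0.
Proof.
  intros H. apply Rle_antisym; [|apply cnt_nonneg].
  replace 0 with (rsum (fun _ => 0) n) by (rewrite rsum_const; lra).
  apply rsum_le; intros v Hv; rewrite (ind_false _ (H v Hv)); lra.
Qed.

Lemma cnt_pos_ex (P : nat -> Prop) (n : nat) : 0 < cnt P n -> exists v, P v.
Proof.
  intros H; apply NNPP; intros HN.
  rewrite cnt_empty in H; [lra|]. intros v _ HP; apply HN; now exists v.
Qed.

Lemma cnt_subsingleton (P : nat -> Prop) (n : nat) :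
  (forall v w, P v -> P w -> v = w) -> cnt P n <= 1.
Proof.
  intros H. induction n as [|n IH]; [unfold cnt; simpl; lra|].
  change (cnt P n + ind (P n) <= 1).
  destruct (classic (P n)) as [HP|HP]; [|rewrite (ind_false _ HP); lra].
  rewrite (ind_true _ HP), cnt_empty; [lra|].
  intros v Hv HP'. rewrite (H v n HP' HP) in Hv; lia.
Qed.

(** Pigeonhole: a cell of length [h] holds at most one value [g v], and [Int_part (l / h) + 1] cells
    starting at [x] suffice. *)
Lemma cnt_separated (P : nat -> Prop) (g : nat -> R) (x l h : R) (n : nat) :
  0 < h -> 0 <= l ->
  (forall v, P v -> x <= g v <= x + l) ->
  (forall v w, P v -> P w -> v <> w -> h <= Rabs (g v - g w)) ->
  cnt P n <= l / h + 1.
Proof.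
  intros Hh Hl Hx Hsep.
  set (f := fun v => (g v - x) / h).
  set (H := Z.to_nat (Int_part (l / h))).
  assert (H0 : 0 <= l / h) by (apply Rle_mult_inv_pos; lra).
  assert (Hfl : forall y, 0 <= y -> (0 <= Int_part y)%Z).
  { intros y Hy. destruct (base_Int_part y) as [_ Hb].
    apply Z.lt_succ_r, lt_IZR; rewrite succ_IZR; lra. }
  assert (HH : INR H <= l / h).
  { unfold H; rewrite INR_IZR_INZ, Z2Nat.id by auto. apply base_Int_part. }
  apply Rle_trans with (rsum (fun i => cnt (fun v => P v /\ Z.to_nat (Int_part (f v)) = i) n) (S H)).
  - apply cnt_union. intros v _ Hv. exists (Z.to_nat (Int_part (f v))). split; [|tauto].
    apply Nat.lt_succ_r, Z2Nat.inj_le; [|now apply Hfl|].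
    { apply Hfl, Rle_mult_inv_pos; [destruct (Hx v Hv); lra | lra]. }
    apply Z.lt_succ_r, lt_IZR. rewrite succ_IZR.
    destruct (base_Int_part (f v)) as [Ha _], (base_Int_part (l / h)) as [_ Hb].
    assert (f v <= l / h).
    { apply Rmult_le_compat_r; [left; now apply Rinv_0_lt_compat | destruct (Hx v Hv); lra]. }
    lra.
  - apply Rle_trans with (rsum (fun _ => 1) (S H)); [|rewrite rsum_const, S_INR; lra].
    apply rsum_le; intros i _. apply cnt_subsingleton.
    intros v w [Hv Hvi] [Hw Hwi]. apply NNPP; intros Hne.
    specialize (Hsep v w Hv Hw Hne).
    assert (Hf : forall z, P z -> 0 <= f z).
    { intros z Hz; apply Rle_mult_inv_pos; [destruct (Hx z Hz); lra | lra]. }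
    assert (Heq : Int_part (f v) = Int_part (f w)).
    { apply Z2Nat.inj; [apply Hfl, Hf, Hv | apply Hfl, Hf, Hw | congruence]. }
    destruct (base_Int_part (f v)) as [Ha Hb], (base_Int_part (f w)) as [Hc Hd].
    rewrite Heq in Ha, Hb.
    assert (Hd1 : Rabs (f v - f w) < 1) by (apply Rabs_def1; lra).
    replace (g v - g w) with ((f v - f w) * h) in Hsep by (unfold f; field; lra).
    rewrite Rabs_mult, (Rabs_pos_eq h) in Hsep by lra. nra.
Qed.

Lemma cnt_open_interval (A B : R) (n : nat) :
  A <= B -> cnt (fun v => A < INR v < B) n <= B - A + 1.
Proof.
  intros HAB.
  replace (B - A + 1) with ((B - A) / 1 + 1) by field.
  apply (cnt_separated _ INR A); [lra | lra | intros; lra |].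
  intros v w _ _ Hne.
  destruct (Nat.lt_total v w) as [Hl|[Hl|Hl]]; [|contradiction|].
  - assert (INR (S v) <= INR w) by (apply le_INR; lia). rewrite S_INR in H.
    rewrite Rabs_minus_sym, Rabs_pos_eq; lra.
  - assert (INR (S w) <= INR v) by (apply le_INR; lia). rewrite S_INR in H.
    rewrite Rabs_pos_eq; lra.
Qed.

Lemma cnt_children (P : nat -> Prop) (n : nat) :
  cnt (fun v => P (v / 8)%nat) (8 * n) = 8 * cnt P n.
Proof.
  induction n as [|n IH]; [unfold cnt; simpl; lra|].
  replace (8 * S n)%nat with (S (S (S (S (S (S (S (S (8 * n)))))))))%nat by lia.
  assert (H : forall i, (i < 8)%nat -> ((i + 8 * n) / 8 = n)%nat).
  { intros i Hi. symmetry; apply (Nat.div_unique _ _ _ i); lia. }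
  unfold cnt in *; cbn [rsum]. rewrite IH.
  pose proof (H 0%nat) as H0; pose proof (H 1%nat) as H1; pose proof (H 2%nat) as H2;
  pose proof (H 3%nat) as H3; pose proof (H 4%nat) as H4; pose proof (H 5%nat) as H5;
  pose proof (H 6%nat) as H6; pose proof (H 7%nat) as H7.
  cbn [plus] in *.
  rewrite H0, H1, H2, H3, H4, H5, H6, H7 by lia. lra.
Qed.

(** Turns a bound valid inside each single ancestor box into one relative to the number of surviving
    ancestors. *)
Lemma cnt_blocks (P : nat -> Prop) (Q : nat -> Prop) (b n N : nat) (C : R) :
  (forall v, (v < N)%nat -> (v / b < n)%nat) ->
  (forall w, (w < n)%nat -> cnt (fun v => (v / b)%nat = w /\ Q v) N <= C) ->
  cnt (fun v => P (v / b)%nat /\ Q v) N <= C * cnt P n.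
Proof.
  intros Hb HC.
  apply Rle_trans with
    (rsum (fun w => cnt (fun v => (v / b)%nat = w /\ P w /\ Q v) N) n).
  - apply cnt_union. intros v Hv [HP HQ]. exists (v / b)%nat. auto.
  - unfold cnt at 2. rewrite <- rsum_scal. apply rsum_le; intros w Hw.
    destruct (classic (P w)) as [HP|HP].
    + rewrite (ind_true _ HP), Rmult_1_r. eapply Rle_trans; [|apply (HC w Hw)].
      apply cnt_le; tauto.
    + rewrite (ind_false _ HP), cnt_empty by tauto. lra.
Qed.

(** * The tree of surviving boxes *)

(** At level [k] the number [v] encodes the half-open box from [v / 8^k] to [(v + 1) / 8^k]; its
    parent has number [v / 8]. *)
Definition hit (B : R -> Prop) (k v : nat) : Prop :=
  exists x, INR v <= 8 ^ k * x < INR v + 1 /\ B x.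

(** [Bad 0] is never consulted: the root box always survives. *)
Fixpoint alive (Bad : nat -> R -> Prop) (k v : nat) : Prop :=
  match k with
  | O => v = 0%nat
  | S j => alive Bad j (v / 8)%nat /\ ~ hit (Bad (S j)) (S j) v
  end.

Lemma INR_8 : INR 8 = 8.
Proof. simpl; lra. Qed.

Lemma pow8_pos (k : nat) : 0 < 8 ^ k.
Proof. apply pow_lt; lra. Qed.

Lemma alive_lt (Bad : nat -> R -> Prop) (k v : nat) :
  alive Bad k v -> (v < 8 ^ k)%nat.
Proof.
  revert v; induction k as [|k IH]; cbn [alive Nat.pow]; intros v H; [lia|].
  destruct H as [H _]. apply IH in H.
  pose proof (Nat.div_mod_eq v 8); pose proof (Nat.mod_upper_bound v 8). lia.
Qed.

Lemma alive_ancestor (Bad : nat -> R -> Prop) (k n v : nat) :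
  alive Bad (k + n) v -> alive Bad k (v / 8 ^ n)%nat.
Proof.
  revert v; induction n as [|n IH]; intros v.
  - rewrite Nat.add_0_r; simpl Nat.pow. rewrite Nat.div_1_r. tauto.
  - rewrite Nat.add_succ_r. intros [H _]. apply IH in H.
    rewrite Nat.Div0.div_div in H. exact H.
Qed.

(** Measured in boxes of the finer level, box [v] lies inside its ancestor [v / b]. *)
Lemma box_div (v b : nat) : (0 < b)%nat ->
  INR (v / b) * INR b <= INR v /\ INR v + 1 <= (INR (v / b) + 1) * INR b.
Proof.
  intros Hb. rewrite <- S_INR, <- S_INR, <- !mult_INR.
  pose proof (Nat.div_mod_eq v b); pose proof (Nat.mod_upper_bound v b).
  split; apply le_INR; nia.
Qed.

(* Least alive boxes have nondecreasing left endpoints, so the endpoints converge; a bad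
   neighbourhood of the limit would contain a late endpoint, hence meet an alive box. *)
Lemma alive_limit (Bad : nat -> R -> Prop) :
  (forall k x, Bad k x -> exists e, 0 < e /\ forall y, Rabs (y - x) < e -> Bad k y) ->
  (forall k, exists v, alive Bad k v) ->
  exists b, 0 <= b <= 1 /\ forall k, ~ Bad (S k) b.
Proof.
  intros Hopen Hne.
  assert (Hmin : forall k, exists v, alive Bad k v /\ forall w, alive Bad k w -> (v <= w)%nat).
  { intros k.
    destruct (dec_inh_nat_subset_has_unique_least_element (alive Bad k)
                (fun n => classic _) (Hne k)) as [v [Hv _]].
    exists v; exact Hv. }
  set (f := fun k => proj1_sig (constructive_indefinite_description _ (Hmin k))).
  assert (Hf : forall k, alive Bad k (f k) /\ forall w, alive Bad k w -> (f k <= w)%nat).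
  { intros k; unfold f; apply proj2_sig. }
  set (x := fun k => INR (f k) / 8 ^ k).
  assert (Hx : forall k, 0 <= x k <= 1).
  { intros k. pose proof (pow8_pos k). unfold x. split.
    - apply Rle_mult_inv_pos; [apply pos_INR | assumption].
    - apply Rmult_le_reg_r with (8 ^ k); [assumption|].
      replace (INR (f k) / 8 ^ k * 8 ^ k) with (INR (f k)) by (field; lra).
      rewrite Rmult_1_l, <- INR_8, <- pow_INR. apply le_INR, Nat.lt_le_incl.
      apply (alive_lt Bad), Hf. }
  assert (Hgrow : Un_growing x).
  { intros k. pose proof (pow8_pos k). unfold x.
    (* The parent of an alive box is alive, so minimality of [f k] applies to it. *)
    assert (HS : (f k <= f (S k) / 8)%nat).
    { apply Hf. destruct (Hf (S k)) as [[Ha _] _]. exact Ha. }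
    assert (H8 : (8 * f k <= f (S k))%nat).
    { pose proof (Nat.div_mod_eq (f (S k)) 8). lia. }
    apply le_INR in H8. rewrite mult_INR, INR_8 in H8.
    apply Rmult_le_reg_r with (8 ^ S k); [apply pow8_pos|].
    simpl. replace (INR (f k) / 8 ^ k * (8 * 8 ^ k)) with (8 * INR (f k)) by (field; lra).
    replace (INR (f (S k)) / (8 * 8 ^ k) * (8 * 8 ^ k)) with (INR (f (S k))) by (field; lra).
    exact H8. }
  assert (Hub : has_ub x).
  { exists 1. intros y [k ->]. apply Hx. }
  destruct (growing_cv x Hgrow Hub) as [b Hb].
  exists b. split; [split|].
  - pose proof (growing_ineq x b Hgrow Hb 0%nat). destruct (Hx 0%nat). lra.
  - apply Rnot_lt_le; intros Hlt.
    destruct (Hb (b - 1) ltac:(lra)) as [N HN]. specialize (HN N (le_n N)).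
    unfold Rdist in HN. apply Rabs_def2 in HN. destruct (Hx N). lra.
  - intros k HBad. destruct (Hopen _ _ HBad) as [e [He Hball]].
    destruct (Hb e He) as [N HN].
    specialize (HN (S k + N)%nat ltac:(lia)). apply Hball in HN.
    set (j := (S k + N)%nat) in *.
    assert (Ha : alive Bad (S k) (f j / 8 ^ N)) by (apply alive_ancestor, Hf).
    destruct Ha as [_ Hno]. apply Hno. exists (x j). split; [|exact HN].
    destruct (box_div (f j) (8 ^ N)) as [H1 H2].
    { apply Nat.neq_0_lt_0, Nat.pow_nonzero; lia. }
    rewrite pow_INR, INR_8 in H1, H2. pose proof (pow8_pos N) as HpN.
    pose proof (pow8_pos (S k)) as Hpk.
    replace (8 ^ S k * x j) with (INR (f j) / 8 ^ N)
      by (unfold x, j; rewrite pow_add; field; lra).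
    split.
    + apply Rmult_le_reg_r with (8 ^ N); [assumption|].
      replace (INR (f j) / 8 ^ N * 8 ^ N) with (INR (f j)) by (field; lra). lra.
    + apply Rmult_lt_reg_r with (8 ^ N); [assumption|].
      replace (INR (f j) / 8 ^ N * 8 ^ N) with (INR (f j)) by (field; lra). lra.
Qed.

(** * Boxes hit by neighbourhoods of fractions *)

(** Since [q >= 8^m], at most [4 q / 8^m] numerators [p] come close to the ancestor box [w], and the
    neighbourhood of radius [d / q] around [p / q] meets at most [2 * 8^k * d / q + 2] boxes of
    level [k]. The bound is the product. *)
Lemma hit_fractions (d : R) (q k m w : nat) :
  (m <= k)%nat -> 8 ^ m <= INR q -> 0 <= d <= 1 ->
  cnt (fun v => (v / 8 ^ (k - m))%nat = w /\
        hit (fun x => exists p : nat, Rabs (INR q * x - INR p) < d) k v) (8 ^ k)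
  <= 8 ^ (k - m) * (8 * d + 8 * INR q / 8 ^ k).
Proof.
  intros Hm Hq Hd.
  pose proof (pow8_pos m) as Hpm; pose proof (pow8_pos k) as Hpk.
  pose proof (pow8_pos (k - m)) as Hpb.
  assert (Hkm : 8 ^ k = 8 ^ (k - m) * 8 ^ m) by (rewrite <- pow_add; f_equal; lia).
  assert (Hq0 : 0 < INR q) by lra.
  (* [p] is at distance less than 1 from [q] times the closed ancestor box; the slack 1 comes from
     [d <= 1]. *)
  set (rel := fun p : nat =>
     INR q * INR w / 8 ^ m - 1 < INR p < INR q * (INR w + 1) / 8 ^ m + 1).
  set (near := fun p v : nat => (v / 8 ^ (k - m))%nat = w /\
     hit (fun x => Rabs (INR q * x - INR p) < d) k v).
  assert (Hrel : forall p v, near p v -> rel p).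
  { intros p v [Hw [x [[Hx1 Hx2] Hp]]].
    destruct (box_div v (8 ^ (k - m))) as [H1 H2].
    { apply Nat.neq_0_lt_0, Nat.pow_nonzero; lia. }
    rewrite Hw, pow_INR, INR_8 in H1, H2.
    assert (Ha : INR w / 8 ^ m <= x).
    { apply Rmult_le_reg_r with (8 ^ k); [assumption|].
      replace (INR w / 8 ^ m * 8 ^ k) with (INR w * 8 ^ (k - m)) by (rewrite Hkm; field; lra). lra. }
    assert (Hb : x <= (INR w + 1) / 8 ^ m).
    { apply Rmult_le_reg_r with (8 ^ k); [assumption|].
      replace ((INR w + 1) / 8 ^ m * 8 ^ k) with ((INR w + 1) * 8 ^ (k - m)) by (rewrite Hkm; field; lra). lra. }
    apply Rabs_def2 in Hp. unfold rel, Rdiv in *. rewrite !Rmult_assoc.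
    apply (Rmult_le_compat_l (INR q)) in Ha, Hb; lra. }
  (* With [r = 8^k d / q], the possible [v] fill an open interval of length [2 r + 1], which
     contains at most [2 r + 2] integers. *)
  set (C := 2 * 8 ^ k * d / INR q + 2).
  assert (HC : 0 <= C).
  { unfold C. assert (0 <= 2 * 8 ^ k * d / INR q) by (apply Rle_mult_inv_pos; nra). lra. }
  assert (Hnear : forall p, cnt (near p) (8 ^ k) <= C).
  { intros p.
    set (z := 8 ^ k * INR p / INR q). set (r := 8 ^ k * d / INR q).
    assert (Hr : 0 <= r) by (apply Rle_mult_inv_pos; nra).
    apply Rle_trans with (cnt (fun v => z - r - 1 < INR v < z + r) (8 ^ k)).
    - apply cnt_le. intros v _ [_ [x [[Hx1 Hx2] Hp]]].
      assert (H : Rabs (8 ^ k * x - z) < r).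
      { replace (8 ^ k * x - z) with (8 ^ k / INR q * (INR q * x - INR p)) by (unfold z; field; lra).
        assert (0 < 8 ^ k / INR q) by (apply Rdiv_lt_0_compat; lra).
        rewrite Rabs_mult, (Rabs_pos_eq (8 ^ k / INR q)) by lra.
        replace r with (8 ^ k / INR q * d) by (unfold r; field; lra).
        now apply Rmult_lt_compat_l. }
      apply Rabs_def2 in H. lra.
    - eapply Rle_trans; [apply cnt_open_interval; lra|].
      replace C with (2 * r + 2) by (unfold C, r; field; lra). lra. }
  apply Rle_trans with (rsum (fun p => cnt (near p) (8 ^ k)) (q + 2)).
  { apply cnt_union. intros v Hv [Hw [x [[Hx1 Hx2] [p Hp]]]]. exists p. split.
    - apply INR_lt. rewrite plus_INR; simpl.
      assert (HvS : INR v + 1 <= 8 ^ k).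
      { rewrite <- S_INR, <- INR_8, <- pow_INR. now apply le_INR. }
      assert (x < 1) by nra.
      apply Rabs_def2 in Hp. nra.
    - split; [exact Hw|]. exists x. tauto. }
  apply Rle_trans with (C * cnt rel (q + 2)).
  { unfold cnt at 2. rewrite <- rsum_scal. apply rsum_le; intros p _.
    destruct (classic (rel p)) as [HP|HP].
    - rewrite (ind_true _ HP), Rmult_1_r. apply Hnear.
    - rewrite (ind_false _ HP), cnt_empty; [lra|]. intros v _ Hv. apply HP, (Hrel p v Hv). }
  assert (Hcr : cnt rel (q + 2) <= 4 * INR q / 8 ^ m).
  { assert (Hqm : 1 <= INR q / 8 ^ m).
    { apply Rmult_le_reg_r with (8 ^ m); [assumption|].
      replace (INR q / 8 ^ m * 8 ^ m) with (INR q) by (field; lra). lra. }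
    replace (4 * INR q / 8 ^ m) with (4 * (INR q / 8 ^ m)) by (field; lra).
    replace (4 * (INR q / 8 ^ m)) with (INR q / 8 ^ m + 3 * (INR q / 8 ^ m)) by ring.
    assert (Heq : INR q * (INR w + 1) / 8 ^ m = INR q * INR w / 8 ^ m + INR q / 8 ^ m) by (field; lra).
    eapply Rle_trans; [apply cnt_open_interval; lra|]. lra. }
  apply Rle_trans with (C * (4 * INR q / 8 ^ m)); [now apply Rmult_le_compat_l|].
  right. unfold C. rewrite Hkm. field. lra.
Qed.

(** The condition [3 m <= k] ensures [8^m <= 2^k <= q]. As [q <= 2 * 2^k] and [8^k = (2^k)^3], each
    [q] contributes a rounding error of at most [16 / 4^k]; the [2^k] of them add up to
    [16 / 2^k]. *)
Lemma hit_fractions_block (delta : nat -> R) (k m w : nat) :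
  (3 * m <= k)%nat -> (forall q, 0 <= delta q) ->
  (forall i, (i < 2 ^ k)%nat -> delta (2 ^ k + i)%nat <= 1) ->
  cnt (fun v => (v / 8 ^ (k - m))%nat = w /\
        hit (fun x => exists q p : nat, (2 ^ k <= q < 2 ^ S k)%nat /\
                        Rabs (INR q * x - INR p) < delta q) k v) (8 ^ k)
  <= 8 ^ (k - m) * (8 * rsum (fun i => delta (2 ^ k + i)%nat) (2 ^ k) + 16 / 2 ^ k).
Proof.
  intros Hm Hd0 Hd1.
  pose proof (pow8_pos k) as Hpk. pose proof (pow8_pos (k - m)) as Hpb.
  assert (H2k : 0 < 2 ^ k) by (apply pow_lt; lra).
  assert (I2 : INR (2 ^ k) = 2 ^ k) by (rewrite pow_INR; simpl; f_equal; lra).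
  assert (H88 : 8 ^ k = 2 ^ k * 2 ^ k * 2 ^ k).
  { rewrite <- !Rpow_mult_distr. f_equal; lra. }
  eapply Rle_trans.
  { apply (cnt_union _ (fun i v => (v / 8 ^ (k - m))%nat = w /\
        hit (fun x => exists p : nat, Rabs (INR (2 ^ k + i) * x - INR p) < delta (2 ^ k + i)%nat) k v)
        (8 ^ k) (2 ^ k)).
    intros v _ [Hw [x [Hx [q [p [Hq Hp]]]]]]. simpl in Hq.
    exists (q - 2 ^ k)%nat. split; [lia|]. split; [exact Hw|].
    exists x. split; [exact Hx|]. exists p.
    replace (2 ^ k + (q - 2 ^ k))%nat with q by lia. exact Hp. }
  apply Rle_trans with
    (rsum (fun i => 8 ^ (k - m) * (8 * delta (2 ^ k + i)%nat + 16 / (2 ^ k * 2 ^ k))) (2 ^ k)).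
  - apply rsum_le; intros i Hi.
    assert (Hqi : 2 ^ k <= INR (2 ^ k + i) <= 2 * 2 ^ k).
    { rewrite <- I2. change 2 with (INR 2). rewrite <- mult_INR. split; apply le_INR; lia. }
    eapply Rle_trans; [apply hit_fractions; [lia| |split; auto]|].
    + apply Rle_trans with (2 ^ k); [|lra].
      replace 8 with (2 ^ 3) by (simpl; lra). rewrite <- pow_mult.
      apply Rle_pow; [lra|lia].
    + apply Rmult_le_compat_l; [lra|]. apply Rplus_le_compat_l.
      replace (16 / (2 ^ k * 2 ^ k)) with (8 * (2 * 2 ^ k) / 8 ^ k) by (rewrite H88; field; lra).
      apply Rmult_le_compat_r; [left; now apply Rinv_0_lt_compat | lra].
  - rewrite rsum_scal, rsum_plus, rsum_scal, rsum_const, I2.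
    right. field. lra.
Qed.

(** * Positivity of the surviving proportion *)

(** The induction carries the ratio bounds [M (i+1) >= M i (1 - 1/(4(i+1)))] together with
    [M k >= 1/(k+1)]. The ratios give [M ((k+1)/3) <= 2 M k], so the first loss is at most
    [M k / (8(k+1))]; so is the second, because [1/(k+1) <= M k]. *)
Lemma mass_positive (M : nat -> R) :
  M 0%nat = 1 -> (forall k, 0 <= M k) -> (forall k, M (S k) <= M k) ->
  (forall k, M k - M (S k / 3)%nat / (16 * INR (S k)) - 1 / (8 * INR (S k) ^ 2) <= M (S k)) ->
  forall k, 0 < M k.
Proof.
  intros H0 Hpos Hdec Hrec.
  assert (Hdec' : forall j n, M (j + n)%nat <= M j).
  { intros j n; induction n as [|n IH]; [rewrite Nat.add_0_r; lra|].
    rewrite Nat.add_succ_r. specialize (Hdec (j + n)%nat). lra. }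
  assert (HS : forall k, 0 < INR (S k)) by (intros; apply lt_0_INR; lia).
  assert (Hmain : forall k, (forall i, (i < k)%nat -> M i * (1 - 1 / (4 * INR (S i))) <= M (S i)) /\
                            1 / INR (S k) <= M k).
  { induction k as [|k [IH1 IH2]].
    { split; [lia|]. rewrite H0; simpl; lra. }
    assert (Hhalf : M (S k / 3)%nat <= 2 * M k).
    { set (j := (S k / 3)%nat).
      assert (Hj : (3 * j <= S k < 3 * j + 3)%nat).
      { unfold j. pose proof (Nat.div_mod_eq (S k) 3); pose proof (Nat.mod_upper_bound (S k) 3). lia. }
      (* By monotonicity each step after [j] costs at most [M j / (4 (j+1))], so the losses add up
         linearly. *)
      assert (Hlow : forall n, (j + n <= k)%nat -> M j * (1 - INR n / (4 * INR (S j))) <= M (j + n)%nat).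
      { induction n as [|n IHn]; intros Hn.
        - rewrite Nat.add_0_r; simpl; unfold Rdiv; lra.
        - specialize (IHn ltac:(lia)). specialize (IH1 (j + n)%nat ltac:(lia)).
          rewrite Nat.add_succ_r, (S_INR n).
          assert (Hinv : 1 / (4 * INR (S (j + n))) <= 1 / (4 * INR (S j))).
          { apply Rmult_le_compat_l; [lra|]. apply Rinv_le_contravar.
            - specialize (HS j); lra.
            - apply Rmult_le_compat_l; [lra|]. apply le_INR; lia. }
          assert (Hip : 0 < 1 / (4 * INR (S j))).
          { apply Rdiv_lt_0_compat; [lra|]. specialize (HS j); lra. }
          assert (Hip2 : 0 < 1 / (4 * INR (S (j + n)))).
          { apply Rdiv_lt_0_compat; [lra|]. specialize (HS (j + n)%nat); lra. }
          replace (M j * (1 - (INR n + 1) / (4 * INR (S j))))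
            with (M j * (1 - INR n / (4 * INR (S j))) - M j * (1 / (4 * INR (S j))))
            by (field; specialize (HS j); lra).
          pose proof (Hdec' j n). pose proof (Hpos (j + n)%nat).
          assert (M (j + n)%nat * (1 / (4 * INR (S (j + n)))) <= M j * (1 / (4 * INR (S j))))
            by (apply Rmult_le_compat; lra).
          lra. }
      specialize (Hlow (k - j)%nat ltac:(lia)).
      replace (j + (k - j))%nat with k in Hlow by lia.
      (* As [k + 1 < 3 j + 3], there are at most [2 (j+1)] steps, which remove at most half of
         [M j]. *)
      assert (INR (k - j) <= 2 * INR (S j)).
      { change 2 with (INR 2). rewrite <- mult_INR. apply le_INR. lia. }
      assert (Hfr : INR (k - j) / (4 * INR (S j)) <= 1 / 2).
      { specialize (HS j). apply Rmult_le_reg_r with (4 * INR (S j)); [lra|].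
        replace (INR (k - j) / (4 * INR (S j)) * (4 * INR (S j))) with (INR (k - j)) by (field; lra). lra. }
      pose proof (Hpos j). nra. }
    assert (Hstep : M k * (1 - 1 / (4 * INR (S k))) <= M (S k)).
    { eapply Rle_trans; [|apply Hrec]. specialize (HS k).
      set (y := INR (S k)) in *.
      assert (Hi : 0 < / y) by now apply Rinv_0_lt_compat.
      replace (1 / (4 * y)) with (/ y / 4) by (field; lra).
      replace (M (S k / 3)%nat / (16 * y)) with (M (S k / 3)%nat * / y / 16) by (field; lra).
      replace (1 / (8 * y ^ 2)) with (/ y * / y / 8) by (field; lra).
      unfold Rdiv in IH2; rewrite Rmult_1_l in IH2.
      assert (M (S k / 3)%nat * / y <= 2 * M k * / y) by (apply Rmult_le_compat_r; lra).
      assert (/ y * / y <= M k * / y) by (apply Rmult_le_compat_r; lra).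
      nra. }
    split.
    - intros i Hi. destruct (Nat.eq_dec i k) as [->|Hne]; [exact Hstep|]. apply IH1; lia.
    - eapply Rle_trans; [|exact Hstep].
      assert (H1 : 1 <= INR (S k)) by (rewrite S_INR; pose proof (pos_INR k); lra).
      rewrite (S_INR (S k)). set (y := INR (S k)) in *.
      apply Rle_trans with (1 / y * (1 - 1 / (4 * y))).
      + apply Rmult_le_reg_r with (4 * y * y * (y + 1)); [nra|].
        replace (1 / (y + 1) * (4 * y * y * (y + 1))) with (4 * y * y) by (field; lra).
        replace (1 / y * (1 - 1 / (4 * y)) * (4 * y * y * (y + 1))) with ((4 * y - 1) * (y + 1)) by (field; lra).
        nra.
      + apply Rmult_le_compat_r; [|exact IH2].
        assert (1 / (4 * y) <= 1); [|lra].
        apply Rmult_le_reg_r with (4 * y); [lra|].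
        replace (1 / (4 * y) * (4 * y)) with 1 by (field; lra). lra. }
  intros k. destruct (Hmain k) as [_ Hk].
  eapply Rlt_le_trans; [|exact Hk]. apply Rdiv_lt_0_compat; [lra | apply HS].
Qed.

(** * Boxes hit by balls, and the avoidance of fractions and balls *)

(** A level has finitely many boxes, so an infinite family may be replaced by a finite subfamily
    that hits the same ones. *)
Lemma bounded_witnesses (Q : nat -> nat -> Prop) (N : nat) :
  exists n, forall v, (v < N)%nat -> (exists i, Q i v) -> exists i, (i < n)%nat /\ Q i v.
Proof.
  induction N as [|N [n IH]]; [exists 0%nat; lia|].
  destruct (classic (exists i, Q i N)) as [[i Hi]|HN].
  - exists (Nat.max n (S i)). intros v Hv Hex.
    destruct (Nat.eq_dec v N) as [->|Hne]; [exists i; split; [lia|exact Hi]|].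
    destruct (IH v ltac:(lia) Hex) as [i' [Hi' HQ]]. exists i'. split; [lia|exact HQ].
  - exists n. intros v Hv Hex. destruct (Nat.eq_dec v N) as [->|Hne]; [contradiction|].
    apply IH; [lia|exact Hex].
Qed.

(** A ball of radius [16 / 8^k] confines [v] to an open interval of length 33, which contains at
    most 34 integers. *)
Lemma hit_balls (u : nat -> R) (I : nat -> Prop) (k : nat) (C : R) :
  (forall n, 34 * cnt I n <= C) ->
  cnt (hit (fun x => exists i, I i /\ Rabs (x - u i) < 16 / 8 ^ k) k) (8 ^ k) <= C.
Proof.
  intros HC. pose proof (pow8_pos k) as Hpk.
  set (Q := fun i v => I i /\ hit (fun x => Rabs (x - u i) < 16 / 8 ^ k) k v).
  destruct (bounded_witnesses Q (8 ^ k)) as [n Hn].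
  apply Rle_trans with (rsum (fun i => cnt (Q i) (8 ^ k)) n).
  { apply cnt_union. intros v Hv [x [Hx [i [Hi Hu]]]]. apply Hn; [exact Hv|].
    exists i. split; [exact Hi|]. exists x. tauto. }
  eapply Rle_trans; [|apply (HC n)]. unfold cnt at 2. rewrite <- rsum_scal.
  apply rsum_le; intros i _.
  destruct (classic (I i)) as [Hi|Hi].
  - rewrite (ind_true _ Hi).
    apply Rle_trans with (cnt (fun v => 8 ^ k * u i - 17 < INR v < 8 ^ k * u i + 16) (8 ^ k)).
    + apply cnt_le. intros v _ [_ [x [Hx Hu]]].
      assert (H : Rabs (8 ^ k * x - 8 ^ k * u i) < 16).
      { rewrite <- Rmult_minus_distr_l, Rabs_mult, (Rabs_pos_eq (8 ^ k)) by lra.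
        replace 16 with (8 ^ k * (16 / 8 ^ k)) by (field; lra).
        now apply Rmult_lt_compat_l. }
      apply Rabs_def2 in H. lra.
    + eapply Rle_trans; [apply cnt_open_interval; lra|]. lra.
  - rewrite (ind_false _ Hi), cnt_empty; [lra|]. intros v _ [Hv _]; contradiction.
Qed.

(** The deletion process freed from its application, where [delta q] is a multiple of the inverse
    weight, [u i] a point of the [i]-th covering set, and [cls i k] assigns that set to the level at
    which it is deleted. *)
Lemma avoid_fractions_and_balls (delta : nat -> R) (K0 : nat) (u : nat -> R)
    (cls : nat -> nat -> Prop) :
  (1 <= K0)%nat -> (forall q, 0 <= delta q) ->
  (forall k, (K0 <= k)%nat ->
     rsum (fun i => delta (2 ^ k + i)%nat) (2 ^ k) <= 1 / (256 * INR k)) ->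
  (forall k, (K0 <= k)%nat -> 16 / 2 ^ k <= 1 / (32 * INR k)) ->
  (forall k n, (1 <= k)%nat -> 34 * cnt (fun i => cls i k) n <= 8 ^ k / (8 * INR k ^ 2)) ->
  exists b, 0 <= b <= 1 /\
    (forall q p : nat, (2 ^ K0 <= q)%nat -> delta q <= Rabs (INR q * b - INR p)) /\
    (forall i k, (1 <= k)%nat -> cls i k -> 16 / 8 ^ k <= Rabs (b - u i)).
Proof.
  intros HK0 Hd0 Hdelta H16 Hcls.
  set (BQ := fun k x => exists q p : nat, (2 ^ k <= q < 2 ^ S k)%nat /\
                        Rabs (INR q * x - INR p) < delta q).
  set (BU := fun k x => exists i, cls i k /\ Rabs (x - u i) < 16 / 8 ^ k).
  set (Bad := fun k x => ((K0 <= k)%nat /\ BQ k x) \/ BU k x).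
  assert (Hopen : forall k x, Bad k x ->
            exists e, 0 < e /\ forall y, Rabs (y - x) < e -> Bad k y).
  { intros k x [[Hk [q [p [Hq Hp]]]]|[i [Hi Hu]]].
    - assert (Hq0 : 0 < INR q).
      { apply lt_0_INR. pose proof (Nat.pow_nonzero 2 k). lia. }
      exists ((delta q - Rabs (INR q * x - INR p)) / INR q). split.
      { apply Rdiv_lt_0_compat; lra. }
      intros y Hy. left. split; [exact Hk|]. exists q, p. split; [exact Hq|].
      apply (Rmult_lt_compat_l (INR q)) in Hy; [|lra].
      replace (INR q * ((delta q - Rabs (INR q * x - INR p)) / INR q))
        with (delta q - Rabs (INR q * x - INR p)) in Hy by (field; lra).
      rewrite <- (Rabs_pos_eq (INR q)) in Hy at 1 by lra. rewrite <- Rabs_mult in Hy.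
      replace (INR q * y - INR p) with (INR q * (y - x) + (INR q * x - INR p)) by ring.
      eapply Rle_lt_trans; [apply Rabs_triang|]. lra.
    - exists (16 / 8 ^ k - Rabs (x - u i)). split; [lra|].
      intros y Hy. right. exists i. split; [exact Hi|].
      replace (y - u i) with ((y - x) + (x - u i)) by ring.
      eapply Rle_lt_trans; [apply Rabs_triang|]. lra. }
  set (M := fun k => cnt (alive Bad k) (8 ^ k) / 8 ^ k).
  assert (HM : forall k, cnt (alive Bad k) (8 ^ k) = M k * 8 ^ k).
  { intros k. unfold M. pose proof (pow8_pos k). field; lra. }
  assert (Hch : forall k, cnt (fun v => alive Bad k (v / 8)%nat) (8 ^ S k) = M k * 8 ^ S k).
  { intros k. change (8 ^ S k)%nat with (8 * 8 ^ k)%nat. rewrite cnt_children, HM.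
    simpl; ring. }
  assert (Hpos : forall k, 0 < M k).
  { apply mass_positive.
    - unfold M, cnt; simpl. rewrite ind_true by reflexivity. field.
    - intros k. apply Rle_mult_inv_pos; [apply cnt_nonneg | apply pow8_pos].
    - intros k. apply Rmult_le_reg_r with (8 ^ S k); [apply pow8_pos|].
      rewrite <- Hch, <- HM. apply cnt_le. intros v _ [H _]; exact H.
    - intros k. set (K := S k). set (m := (K / 3)%nat).
      assert (Hm : (3 * m <= K)%nat /\ (m <= k)%nat).
      { unfold m, K. pose proof (Nat.div_mod_eq (S k) 3). lia. }
      destruct Hm as [Hm3 Hmk].
      pose proof (pow8_pos K) as HpK.
      assert (HK : 0 < INR K) by (apply lt_0_INR; unfold K; lia).
      assert (HKm : 8 ^ K = 8 ^ (K - m) * 8 ^ m).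
      { rewrite <- pow_add; f_equal; unfold K; lia. }
      (* A child hit by a fraction is counted over its ancestor at level [m = K / 3] rather than
         over its parent: the equidistribution estimate is available for boxes of that size. *)
      assert (Hcover : cnt (fun v => alive Bad k (v / 8)%nat) (8 ^ K) <=
                cnt (alive Bad K) (8 ^ K) +
                (cnt (fun v => alive Bad m (v / 8 ^ (K - m))%nat /\
                         ((K0 <= K)%nat /\ hit (BQ K) K v)) (8 ^ K)
                + cnt (hit (BU K) K) (8 ^ K))).
      { eapply Rle_trans; [apply (cnt_or _ (alive Bad K)
            (fun v => alive Bad k (v / 8)%nat /\ hit (Bad K) K v))|].
        - intros v _ H. destruct (classic (hit (Bad K) K v)); [right|left; split]; auto.
        - apply Rplus_le_compat_l, cnt_or. intros v _ [Ha [x [Hx [[Hk HQ]|HU]]]].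
          + left. split; [|split; [exact Hk | now exists x]].
            replace k with (m + (k - m))%nat in Ha by lia.
            apply alive_ancestor in Ha. rewrite Nat.Div0.div_div in Ha.
            replace (8 ^ (K - m))%nat with (8 * 8 ^ (k - m))%nat; [exact Ha|].
            unfold K. replace (S k - m)%nat with (S (k - m)) by lia. reflexivity.
          + right. now exists x. }
      assert (HQ : cnt (fun v => alive Bad m (v / 8 ^ (K - m))%nat /\
                         ((K0 <= K)%nat /\ hit (BQ K) K v)) (8 ^ K)
                   <= 8 ^ (K - m) * (1 / (16 * INR K)) * cnt (alive Bad m) (8 ^ m)).
      { apply cnt_blocks.
        - intros v Hv. apply Nat.Div0.div_lt_upper_bound.
          rewrite <- Nat.pow_add_r. replace (K - m + m)%nat with K by (unfold K; lia). exact Hv.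
        - intros w _. pose proof (pow8_pos (K - m)) as Hp.
          assert (Hi : 0 < 1 / (16 * INR K)) by (apply Rdiv_lt_0_compat; lra).
          destruct (le_lt_dec K0 K) as [Hk|Hk].
          + eapply Rle_trans; [apply cnt_le with (Q := fun v => (v / 8 ^ (K - m))%nat = w /\ hit (BQ K) K v); tauto|].
            eapply Rle_trans; [apply hit_fractions_block; [exact Hm3|exact Hd0|]|].
            * intros i Hi'.
              apply Rle_trans with (rsum (fun i => delta (2 ^ K + i)%nat) (2 ^ K)).
              { apply (rsum_term_le (fun i => delta (2 ^ K + i)%nat)); auto. }
              eapply Rle_trans; [apply Hdelta, Hk|].
              apply Rmult_le_reg_r with (256 * INR K); [lra|].
              replace (1 / (256 * INR K) * (256 * INR K)) with 1 by (field; lra).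
              assert (1 <= INR K) by (apply (le_INR 1); unfold K; lia). lra.
            * apply Rmult_le_compat_l; [lra|].
              (* The constants 256 and 32 of the hypotheses are chosen for this identity. *)
              replace (1 / (16 * INR K)) with (8 * (1 / (256 * INR K)) + 1 / (32 * INR K)) by (field; lra).
              pose proof (Hdelta K Hk). pose proof (H16 K Hk). lra.
          + rewrite cnt_empty; [nra|]. intros v _ H. lia. }
      assert (HU : cnt (hit (BU K) K) (8 ^ K) <= 8 ^ K / (8 * INR K ^ 2)).
      { apply hit_balls with (I := fun i => cls i K). intros n. apply Hcls. unfold K; lia. }
      unfold K in Hcover at 1. rewrite Hch in Hcover. fold K in Hcover. rewrite !HM in *.
      apply Rmult_le_reg_r with (8 ^ K); [assumption|].
      replace ((M k - M m / (16 * INR K) - 1 / (8 * INR K ^ 2)) * 8 ^ K)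
        with (M k * 8 ^ K - 8 ^ (K - m) * (1 / (16 * INR K)) * (M m * 8 ^ m)
              - 8 ^ K / (8 * INR K ^ 2)) by (rewrite HKm; field; lra).
      lra. }
  destruct (alive_limit Bad Hopen) as [b [Hb Hno]].
  { intros k. apply cnt_pos_ex with (8 ^ k)%nat. rewrite HM.
    apply Rmult_lt_0_compat; [apply Hpos | apply pow8_pos]. }
  exists b. split; [exact Hb|]. split.
  - intros q p Hq. apply Rnot_lt_le; intros Hlt.
    assert (Hq0 : (0 < q)%nat) by (pose proof (Nat.pow_nonzero 2 K0); lia).
    (* The denominator [q] was treated at level [log2 q], which is at least [K0]. *)
    pose proof (Nat.log2_spec q Hq0) as Hlog.
    assert (Hk : (K0 <= Nat.log2 q)%nat) by (apply Nat.log2_le_pow2; auto).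
    destruct (Nat.log2 q) as [|k] eqn:E; [lia|].
    apply (Hno k). left. split; [exact Hk|]. exists q, p. split; [exact Hlog|exact Hlt].
  - intros i k Hk Hi. apply Rnot_lt_le; intros Hlt.
    destruct k as [|k]; [lia|]. apply (Hno k). right. exists i. split; assumption.
Qed.

(** * Distances to the nearest integer and the block sums *)

Lemma dnint_bound (x : R) : 0 <= dnint x <= 1 / 2.
Proof.
  unfold dnint. destruct (base_fp x) as [H1 H2].
  destruct (Rle_dec (frac_part x) (1 - frac_part x)).
  - rewrite Rmin_left; lra.
  - rewrite Rmin_right; lra.
Qed.

Lemma dnint_le_dist (x : R) (p : Z) : dnint x <= Rabs (x - IZR p).
Proof.
  unfold dnint. destruct (base_fp x) as [H1 H2].
  pose proof (Rplus_Int_part_frac_part x) as Hx. set (f := frac_part x) in *.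
  destruct (Z_le_gt_dec p (Int_part x)) as [Hp|Hp].
  - apply IZR_le in Hp. eapply Rle_trans; [apply Rmin_l|].
    eapply Rle_trans; [|apply Rle_abs]. lra.
  - assert (Hp' : (Int_part x + 1 <= p)%Z) by lia. apply IZR_le in Hp'. rewrite plus_IZR in Hp'.
    eapply Rle_trans; [apply Rmin_r|]. rewrite Rabs_minus_sym.
    eapply Rle_trans; [|apply Rle_abs]. lra.
Qed.

Lemma dnint_attained (x : R) : exists p : Z, Rabs (x - IZR p) = dnint x.
Proof.
  unfold dnint. destruct (base_fp x) as [H1 H2].
  pose proof (Rplus_Int_part_frac_part x) as Hx. set (f := frac_part x) in *.
  destruct (Rle_dec f (1 - f)).
  - exists (Int_part x). rewrite Rmin_left, Rabs_pos_eq; lra.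
  - exists (Int_part x + 1)%Z. rewrite plus_IZR, Rmin_right by lra.
    rewrite Rabs_minus_sym, Rabs_pos_eq; lra.
Qed.

(** The deleted fractions have natural numerators; a negative integer is at distance at least 1 from
    [x >= 0], hence never a nearest one. *)
Lemma dnint_attained_nat (x : R) : 0 <= x -> exists p : nat, Rabs (x - INR p) = dnint x.
Proof.
  intros Hx. destruct (dnint_attained x) as [p Hp]. exists (Z.to_nat p).
  rewrite INR_IZR_INZ, Z2Nat.id; [exact Hp|].
  destruct (Z_lt_ge_dec p 0) as [Hneg|]; [|lia].
  assert (Hp1 : (p <= -1)%Z) by lia. apply IZR_le in Hp1.
  pose proof (dnint_bound x). rewrite Rabs_pos_eq in Hp; lra.
Qed.

(** Let [p] and [r] be nearest integers. If [x - p] and [y - r] have the same sign, their difference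
    has absolute value [|dnint x - dnint y|]; otherwise their sum does. *)
Lemma dnint_diff (x y : R) :
  dnint (x - y) <= Rabs (dnint x - dnint y) \/ dnint (x + y) <= Rabs (dnint x - dnint y).
Proof.
  destruct (dnint_attained x) as [p Hp], (dnint_attained y) as [r Hr].
  assert (Hs : forall z, z = Rabs z \/ z = - Rabs z).
  { intros z. unfold Rabs; destruct (Rcase_abs z); lra. }
  pose proof (dnint_le_dist (x - y) (p - r)) as H1. rewrite minus_IZR in H1.
  pose proof (dnint_le_dist (x + y) (p + r)) as H2. rewrite plus_IZR in H2.
  replace (x - y - (IZR p - IZR r)) with ((x - IZR p) - (y - IZR r)) in H1 by ring.
  replace (x + y - (IZR p + IZR r)) with ((x - IZR p) + (y - IZR r)) in H2 by ring.
  rewrite <- Hp, <- Hr.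
  destruct (Hs (x - IZR p)) as [Ex|Ex], (Hs (y - IZR r)) as [Ey|Ey];
    rewrite Ex, Ey in H1, H2;
    set (X := Rabs (x - IZR p)) in *; set (Y := Rabs (y - IZR r)) in *.
  - left; exact H1.
  - right; exact H2.
  - right. replace (- X + Y) with (- (X - Y)) in H2 by ring. now rewrite Rabs_Ropp in H2.
  - left. replace (- X - - Y) with (- (X - Y)) in H1 by ring. now rewrite Rabs_Ropp in H1.
Qed.

(** Up to sign, [q - r] and [q + r] lie between 1 and [2 N], and for such multiples of [alpha] bad
    approximability gives [dnint] at least [c / (2 N)]. *)
Lemma dnint_separated (alpha c : R) (N q r : nat) :
  0 < c -> (forall n : nat, (1 <= n)%nat -> c <= INR n * dnint (INR n * alpha)) ->
  (q <= N)%nat -> (r <= N)%nat -> q <> r ->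
  c / (2 * INR N) <= Rabs (dnint (INR q * alpha) - dnint (INR r * alpha)).
Proof.
  intros Hc Hbad.
  assert (Hlow : forall n : nat, (1 <= n <= 2 * N)%nat -> c / (2 * INR N) <= dnint (INR n * alpha)).
  { intros n Hn. specialize (Hbad n ltac:(lia)).
    pose proof (dnint_bound (INR n * alpha)).
    assert (INR n <= 2 * INR N) by (change 2 with (INR 2); rewrite <- mult_INR; apply le_INR; lia).
    assert (0 < INR N) by (apply lt_0_INR; lia).
    apply Rmult_le_reg_r with (2 * INR N); [lra|].
    replace (c / (2 * INR N) * (2 * INR N)) with c by (field; lra). nra. }
  assert (Hlt : forall q r : nat, (q <= N)%nat -> (r < q)%nat ->
     c / (2 * INR N) <= Rabs (dnint (INR q * alpha) - dnint (INR r * alpha))).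
  { clear q r. intros q r Hq Hr.
    destruct (dnint_diff (INR q * alpha) (INR r * alpha)) as [H|H].
    - rewrite <- Rmult_minus_distr_r, <- minus_INR in H by lia.
      eapply Rle_trans; [apply Hlow|exact H]. lia.
    - rewrite <- Rmult_plus_distr_r, <- plus_INR in H.
      eapply Rle_trans; [apply Hlow|exact H]. lia. }
  intros Hq Hr Hne. destruct (Nat.lt_total q r) as [H|[H|H]]; [|contradiction|auto].
  rewrite Rabs_minus_sym. auto.
Qed.

(** * Elementary estimates for logarithms and real powers *)

Lemma geometric_scale (r t : R) : 0 < r < 1 -> 0 < t <= 1 ->
  exists n, r ^ S n < t <= r ^ n.
Proof.
  intros Hr Ht.
  assert (Hex : exists n, r ^ n < t).
  { destruct (pow_lt_1_zero r ltac:(rewrite Rabs_pos_eq; lra) t ltac:(lra)) as [N HN].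
    exists N. specialize (HN N (le_n N)). apply Rabs_def2 in HN. lra. }
  destruct Hex as [n Hn]. induction n as [|n IH]; [simpl in Hn; lra|].
  destruct (Rlt_dec (r ^ n) t) as [H|H]; [auto|]. exists n. lra.
Qed.

Lemma ln_le_compat (x y : R) : 0 < x -> x <= y -> ln x <= ln y.
Proof.
  intros Hx [Hlt| ->]; [left; now apply ln_increasing | right; reflexivity].
Qed.

Lemma Rpower_pos (x y : R) : 0 < Rpower x y.
Proof. apply exp_pos. Qed.

(** Add [b] times [H1] and [1 - b] times [H2], both consequences of [1 + w <= exp w]: the terms
    linear in [z] cancel. *)
Lemma Rpower_bernoulli (y b : R) : 0 < y -> 0 < b < 1 -> Rpower y b <= 1 + b * (y - 1).
Proof.
  intros Hy Hb. unfold Rpower. set (z := ln y).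
  rewrite <- (exp_ln y) by assumption. fold z.
  pose proof (exp_pos (b * z)) as Hp.
  assert (H : forall w, 1 + w <= exp w) by (intros w; pose proof (exp_ineq1_le w); lra).
  assert (H1 : exp (b * z) * (1 + (1 - b) * z) <= exp z).
  { replace z with (b * z + (1 - b) * z) at 3 by ring. rewrite exp_plus.
    apply Rmult_le_compat_l; [lra|apply H]. }
  assert (H2 : exp (b * z) * (1 - b * z) <= 1).
  { apply Rle_trans with (exp (b * z) * exp (- (b * z))).
    2:{ right. rewrite <- exp_plus, Rplus_opp_r. apply exp_0. }
    apply Rmult_le_compat_l; [lra|]. specialize (H (- (b * z))). lra. }
  nra.
Qed.

(** Discrete integral comparison: the Bernoulli bound gives [(1-a) (x+1)^(-a) <= (x+1)^(1-a) -
    x^(1-a)], which telescopes. *)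
Lemma sum_Rpower_le (a : R) (J : nat) : 0 < a < 1 ->
  rsum (fun n => / Rpower (INR (S n)) a) (S J) <= Rpower (INR (S J)) (1 - a) / (1 - a).
Proof.
  intros Ha. apply Rmult_le_reg_r with (1 - a); [lra|].
  replace (Rpower (INR (S J)) (1 - a) / (1 - a) * (1 - a)) with (Rpower (INR (S J)) (1 - a)) by (field; lra).
  induction J as [|J IH].
  - cbn [rsum]. change (INR 1) with 1. unfold Rpower. rewrite ln_1, !Rmult_0_r, exp_0. lra.
  - change (rsum (fun n => / Rpower (INR (S n)) a) (S (S J)))
      with (rsum (fun n => / Rpower (INR (S n)) a) (S J) + / Rpower (INR (S (S J))) a).
    rewrite Rmult_plus_distr_r. eapply Rle_trans; [apply Rplus_le_compat_r, IH|].
    set (x := INR (S J)) in *. rewrite (S_INR (S J)). fold x.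
    assert (Hx : 0 < x) by (apply lt_0_INR; lia).
    set (P := Rpower (x + 1) (1 - a)).
    assert (HP : 0 < P) by apply Rpower_pos.
    replace (/ Rpower (x + 1) a) with (P * / (x + 1)).
    2:{ unfold P. rewrite <- Rpower_Ropp. replace (- a) with (1 - a + - (1)) by ring.
        rewrite Rpower_plus, Rpower_Ropp, Rpower_1 by lra. reflexivity. }
    replace (Rpower x (1 - a)) with (P * Rpower (x / (x + 1)) (1 - a)).
    2:{ unfold P. rewrite Rpower_mult_distr; [f_equal; field; lra | lra |].
        apply Rdiv_lt_0_compat; lra. }
    assert (HB : Rpower (x / (x + 1)) (1 - a) <= 1 + (1 - a) * (x / (x + 1) - 1)).
    { apply Rpower_bernoulli; [apply Rdiv_lt_0_compat; lra | lra]. }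
    replace (x / (x + 1) - 1) with (- / (x + 1)) in HB by (field; lra).
    apply (Rmult_le_compat_l P) in HB; lra.
Qed.

(** * Weights and their reciprocals over dyadic blocks *)

(** This is [term] without its factor containing [beta]; where it is positive, [term >= c] means
    that [dnint (q beta)] is at least [c / weight]. *)
Definition weight (a alpha : R) (q : nat) : R :=
  INR q * Rpower (ln (INR q)) (2 - a)
        * Rpower (ln (1 / dnint (INR q * alpha))) a
        * dnint (INR q * alpha).

Lemma weight_nonneg (a alpha : R) (q : nat) : 0 <= weight a alpha q.
Proof.
  unfold weight. pose proof (dnint_bound (INR q * alpha)).
  repeat apply Rmult_le_pos; try (left; apply Rpower_pos); [apply pos_INR | lra].
Qed.

(** Because [ln 2 > 1/2], the two logarithms are at least [k / 2] and [(n + 1) / 2]. The shells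
    start at [1/2], the largest possible value of [dnint], which keeps the second logarithm away
    from 0. *)
Lemma weight_lower (a alpha : R) (k n q : nat) : 0 < a < 1 -> (1 <= k)%nat ->
  (2 ^ k <= q)%nat ->
  (1 / 2) ^ S (S n) < dnint (INR q * alpha) <= (1 / 2) ^ S n ->
  2 ^ k * Rpower (INR k / 2) (2 - a) * Rpower (INR (S n) / 2) a * (1 / 2) ^ S (S n)
  <= weight a alpha q.
Proof.
  intros Ha Hk Hq Ht. unfold weight. set (t := dnint (INR q * alpha)) in *.
  assert (H2k : 0 < 2 ^ k) by (apply pow_lt; lra).
  assert (Hh : 0 < (1 / 2) ^ S (S n)) by (apply pow_lt; lra).
  assert (Hq' : 2 ^ k <= INR q).
  { replace 2 with (INR 2) by (simpl; lra). rewrite <- pow_INR. now apply le_INR. }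
  assert (Hkp : 0 < INR k) by (apply lt_0_INR; lia).
  assert (Hnp : 0 < INR (S n)) by (apply lt_0_INR; lia).
  pose proof ln_lt_2 as Hln2.
  assert (Hlnp : forall m, ln (2 ^ m) = INR m * ln 2) by (intros; apply ln_pow; lra).
  assert (Hlq : INR k / 2 <= ln (INR q)).
  { apply Rle_trans with (ln (2 ^ k)); [rewrite Hlnp; nra|]. apply ln_le_compat; lra. }
  assert (Hlt : INR (S n) / 2 <= ln (1 / t)).
  { apply Rle_trans with (ln (2 ^ S n)); [rewrite Hlnp; nra|].
    apply ln_le_compat; [apply pow_lt; lra|].
    replace (2 ^ S n) with (/ (1 / 2) ^ S n).
    - unfold Rdiv at 2. rewrite Rmult_1_l. apply Rinv_le_contravar; lra.
    - rewrite <- pow_inv. f_equal. lra. }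
  pose proof (Rpower_pos (INR k / 2) (2 - a)). pose proof (Rpower_pos (INR (S n) / 2) a).
  repeat apply Rmult_le_compat; try lra; try (apply Rle_Rpower_l; lra);
    repeat apply Rmult_le_pos; lra.
Qed.

(* Separation leaves O(2^(k-n)) values of q in the block with dnint (q alpha) of order
   2^-n, each of weight at least of order 2^(k-n) k^(2-a) n^a; then sum n^-a over n <= k + O(1). *)
Lemma weight_block_sum (a alpha : R) : 0 < a < 1 -> badly_approximable alpha ->
  exists C, 0 < C /\ forall k, (1 <= k)%nat ->
    rsum (fun i => / weight a alpha (2 ^ k + i)%nat) (2 ^ k) <= C / INR k.
Proof.
  intros Ha [c [Hc Hbad]].
  (* Bad approximability keeps [t i] above [c / (2 * 2^k)]; with this [A], only the shells
     [n < k + A] are nonempty. *)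
  assert (HA : exists A : nat, 2 / c <= 2 ^ A).
  { destruct (Pow_x_infinity 2 ltac:(rewrite Rabs_pos_eq; lra) (2 / c)) as [N HN].
    exists N. specialize (HN N (le_n N)).
    rewrite Rabs_pos_eq in HN; [lra | left; apply pow_lt; lra]. }
  destruct HA as [A HA].
  exists (64 / c * (INR (S A) / (1 - a))). split.
  { apply Rmult_lt_0_compat; apply Rdiv_lt_0_compat; try lra. apply lt_0_INR; lia. }
  intros k Hk.
  assert (Hkp : 0 < INR k) by (apply lt_0_INR; lia).
  assert (H2k : 0 < 2 ^ k) by (apply pow_lt; lra).
  assert (I2 : INR (2 ^ k) = 2 ^ k) by (rewrite pow_INR; simpl; f_equal; lra).
  pose proof (Nat.pow_nonzero 2 k ltac:(lia)) as H2n.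
  set (J := (k + A)%nat).
  set (t := fun i => dnint (INR (2 ^ k + i) * alpha)).
  set (D := fun n i => (i < 2 ^ k)%nat /\ (1 / 2) ^ S (S n) < t i <= (1 / 2) ^ S n).
  set (W := fun n => 2 ^ k * Rpower (INR k / 2) (2 - a) * Rpower (INR (S n) / 2) a * (1 / 2) ^ S (S n)).
  assert (Hhalf : forall n, 0 < (1 / 2) ^ n) by (intros; apply pow_lt; lra).
  assert (HW : forall n, 0 < W n).
  { intros n. unfold W. specialize (Hhalf (S (S n))).
    repeat (apply Rmult_lt_0_compat; [|first [apply Rpower_pos | exact Hhalf]]); exact H2k. }
  assert (Htlow : forall i, (i < 2 ^ k)%nat -> c <= 2 * 2 ^ k * t i).
  { intros i Hi. specialize (Hbad (2 ^ k + i)%nat ltac:(lia)). fold (t i) in Hbad.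
    assert (INR (2 ^ k + i) <= 2 * 2 ^ k).
    { rewrite <- I2. change 2 with (INR 2).
      rewrite <- mult_INR. apply le_INR; lia. }
    pose proof (dnint_bound (INR (2 ^ k + i) * alpha)) as Hb. fold (t i) in Hb. nra. }
  assert (Hlow : forall n i, D n i -> c <= 2 * 2 ^ k * (1 / 2) ^ S n).
  { intros n i [Hi Ht]. specialize (Htlow i Hi). nra. }
  (* A nonempty shell satisfies [Hlow], which absorbs the extra 1 of the pigeonhole bound when the
     constant 4 is raised to 8. *)
  assert (Hcnt : forall n, cnt (D n) (2 ^ k) <= 8 * 2 ^ k * (1 / 2) ^ S n / c).
  { intros n. specialize (Hhalf (S n)).
    destruct (classic (exists i, D n i)) as [[i Hi]|Hno].
    - specialize (Hlow n i Hi).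
      apply Rle_trans with ((1 / 2) ^ S n / (c / (4 * 2 ^ k)) + 1).
      + apply (cnt_separated _ t 0); [apply Rdiv_lt_0_compat; lra | lra | |].
        * intros v [_ Hv].
          pose proof (dnint_bound (INR (2 ^ k + v) * alpha)) as Hb. fold (t v) in Hb. lra.
        * intros v w [Hv _] [Hw _] Hne.
          replace (c / (4 * 2 ^ k)) with (c / (2 * INR (2 * 2 ^ k)))
            by (rewrite mult_INR, I2; simpl; f_equal; ring).
          apply dnint_separated; try assumption; lia.
      + apply Rmult_le_reg_r with c; [assumption|].
        replace (8 * 2 ^ k * (1 / 2) ^ S n / c * c) with (8 * 2 ^ k * (1 / 2) ^ S n) by (field; lra).
        replace (((1 / 2) ^ S n / (c / (4 * 2 ^ k)) + 1) * c) with (4 * 2 ^ k * (1 / 2) ^ S n + c) by (field; lra).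
        nra.
    - rewrite cnt_empty by (intros v _ Hv; apply Hno; now exists v).
      apply Rle_mult_inv_pos; [|assumption]. nra. }
  apply Rle_trans with (rsum (fun i => rsum (fun n => / W n * ind (D n i)) J) (2 ^ k)).
  { apply rsum_le; intros i Hi.
    specialize (Htlow i Hi).
    pose proof (dnint_bound (INR (2 ^ k + i) * alpha)) as Hb. fold (t i) in Hb.
    assert (Ht0 : 0 < t i) by nra.
    (* The factor 2 matches the shells [D n], which begin at [1/2] instead of 1. *)
    destruct (geometric_scale (1 / 2) (2 * t i)) as [n Hn]; [lra | lra |].
    assert (HD : D n i).
    { split; [exact Hi|]. change ((1 / 2) ^ S (S n)) with (1 / 2 * (1 / 2) ^ S n).
      change ((1 / 2) ^ S n) with (1 / 2 * (1 / 2) ^ n) at 2. lra. }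
    assert (HnJ : (n < J)%nat).
    { specialize (Hlow n i HD).
      apply Nat.nle_gt; intros HJ.
      assert (Hp : (1 / 2) ^ S n <= (1 / 2) ^ S J).
      { replace (1 / 2) with (/ 2) by lra. rewrite !pow_inv.
        apply Rinv_le_contravar; [apply pow_lt; lra|]. apply Rle_pow; [lra|lia]. }
      assert (H2A : 0 < 2 ^ A) by (apply pow_lt; lra).
      assert (Hval : 2 * 2 ^ k * (1 / 2) ^ S J = / 2 ^ A).
      { replace (1 / 2) with (/ 2) by lra. rewrite pow_inv. unfold J.
        change (2 ^ S (k + A)) with (2 * 2 ^ (k + A)). rewrite pow_add. field. lra. }
      assert (Hle : c <= / 2 ^ A) by nra.
      apply (Rmult_le_compat_r (2 ^ A)) in Hle; [|lra]. rewrite Rinv_l in Hle by lra.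
      apply (Rmult_le_compat_l c) in HA; [|lra].
      replace (c * (2 / c)) with 2 in HA by (field; lra). lra. }
    apply Rle_trans with (/ W n * ind (D n i)).
    - rewrite (ind_true _ HD), Rmult_1_r. apply Rinv_le_contravar; [apply HW|].
      apply weight_lower; [assumption | assumption | lia | exact (proj2 HD)].
    - apply (rsum_term_le (fun n => / W n * ind (D n i))); [|exact HnJ].
      intros j _. apply Rmult_le_pos; [left; apply Rinv_0_lt_compat, HW | apply ind_bound]. }
  rewrite rsum_swap.
  apply Rle_trans with (rsum (fun n => 64 / c * / Rpower (INR k) (2 - a) * / Rpower (INR (S n)) a) J).
  { apply rsum_le; intros n _. rewrite rsum_scal.
    change (rsum (fun i => ind (D n i)) (2 ^ k)) with (cnt (D n) (2 ^ k)).
    eapply Rle_trans.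
    { apply Rmult_le_compat_l; [left; apply Rinv_0_lt_compat, HW | apply Hcnt]. }
    right. unfold W.
    (* The exponents [2 - a] and [a] add up to 2, so the halvings inside the powers cost a factor 4
       whatever [a] is. *)
    assert (Hq : Rpower (/ 2) (2 - a) * Rpower (/ 2) a = / 4).
    { rewrite <- Rpower_plus. replace (2 - a + a) with (INR 2) by (simpl; ring).
      rewrite Rpower_pow by lra. simpl; lra. }
    unfold Rdiv at 1 2.
    assert (Hnp : 0 < INR (S n)) by (apply lt_0_INR; lia).
    rewrite <- !Rpower_mult_distr by lra.
    pose proof (Rpower_pos (INR k) (2 - a)) as P1. pose proof (Rpower_pos (INR (S n)) a) as P2.
    pose proof (Rpower_pos (/ 2) (2 - a)) as P3. pose proof (Rpower_pos (/ 2) a) as P4.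
    specialize (Hhalf (S n)). change ((1 / 2) ^ S (S n)) with (1 / 2 * (1 / 2) ^ S n).
    set (h := (1 / 2) ^ S n) in *.
    transitivity (16 / c * / Rpower (INR k) (2 - a) * / Rpower (INR (S n)) a
                  * / (Rpower (/ 2) (2 - a) * Rpower (/ 2) a)).
    - field. repeat split; lra.
    - rewrite Hq. field. repeat split; lra. }
  rewrite rsum_scal.
  assert (HJ : J = S (J - 1)) by (unfold J; lia).
  pose proof (sum_Rpower_le a (J - 1) Ha) as Hs. rewrite <- HJ in Hs.
  (* This keeps [J^(1-a)] within a constant of [k^(1-a)], and [k^(1-a) / k^(2-a) = 1 / k]. *)
  assert (HJk : INR J <= INR (S A) * INR k).
  { rewrite <- mult_INR. apply le_INR. unfold J. nia. }
  assert (HA1 : 1 <= INR (S A)) by (rewrite S_INR; pose proof (pos_INR A); lra).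
  assert (HJp : Rpower (INR J) (1 - a) <= INR (S A) * Rpower (INR k) (1 - a)).
  { eapply Rle_trans; [apply Rle_Rpower_l with (b := INR (S A) * INR k)|].
    - lra.
    - split; [apply lt_0_INR; lia | exact HJk].
    - rewrite <- Rpower_mult_distr by lra.
      apply Rmult_le_compat_r; [left; apply Rpower_pos|].
      rewrite <- (Rpower_1 (INR (S A))) at 2 by lra. apply Rle_Rpower; lra. }
  pose proof (Rpower_pos (INR k) (2 - a)) as Pk.
  assert (Hkk : Rpower (INR k) (2 - a) = INR k * Rpower (INR k) (1 - a)).
  { replace (2 - a) with (1 + (1 - a)) by ring. now rewrite Rpower_plus, Rpower_1 by lra. }
  pose proof (Rpower_pos (INR k) (1 - a)) as Pk1.
  assert (H64 : 0 < 64 / c * / Rpower (INR k) (2 - a)).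
  { apply Rmult_lt_0_compat; [apply Rdiv_lt_0_compat; lra | now apply Rinv_0_lt_compat]. }
  apply Rle_trans with (64 / c * / Rpower (INR k) (2 - a) * (INR (S A) * Rpower (INR k) (1 - a) / (1 - a))).
  - apply Rmult_le_compat_l; [lra|]. eapply Rle_trans; [exact Hs|].
    apply Rmult_le_compat_r; [left; apply Rinv_0_lt_compat; lra | exact HJp].
  - right. rewrite Hkk. field. repeat split; lra.
Qed.

(** * Hausdorff dimension *)

(** Telescoping again: [(s-1) (x+1)^(-s) <= x^(1-s) - (x+1)^(1-s)], from [exp w >= 1 + w] and
    [ln y <= y - 1]. *)
Lemma sum_Rpower_gt1_le (s : R) (N : nat) : 1 < s ->
  rsum (fun n => Rpower (INR (S n)) (- s)) N <= s / (s - 1).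
Proof.
  intros Hs.
  assert (Hstep : forall n, rsum (fun n => Rpower (INR (S n)) (- s)) (S n) * (s - 1)
                            <= s - Rpower (INR (S n)) (1 - s)).
  { induction n as [|n IH].
    - cbn [rsum]. change (INR 1) with 1. unfold Rpower. rewrite ln_1, !Rmult_0_r, exp_0. lra.
    - change (rsum (fun n => Rpower (INR (S n)) (- s)) (S (S n)))
        with (rsum (fun n => Rpower (INR (S n)) (- s)) (S n) + Rpower (INR (S (S n))) (- s)).
      rewrite Rmult_plus_distr_r. eapply Rle_trans; [apply Rplus_le_compat_r, IH|].
      set (x := INR (S n)) in *. rewrite (S_INR (S n)). fold x.
      assert (Hx : 0 < x) by (apply lt_0_INR; lia).
      set (P := Rpower (x + 1) (1 - s)).
      assert (HP : 0 < P) by apply Rpower_pos.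
      replace (Rpower (x + 1) (- s)) with (P * / (x + 1)).
      2:{ unfold P. replace (- s) with (1 - s + - (1)) by ring.
          rewrite Rpower_plus, Rpower_Ropp, Rpower_1 by lra. reflexivity. }
      assert (Hy : 0 < x / (x + 1)) by (apply Rdiv_lt_0_compat; lra).
      replace (Rpower x (1 - s)) with (P * Rpower (x / (x + 1)) (1 - s)).
      2:{ unfold P. rewrite Rpower_mult_distr by lra. f_equal; field; lra. }
      assert (HB : 1 + (s - 1) * / (x + 1) <= Rpower (x / (x + 1)) (1 - s)).
      { unfold Rpower. pose proof (exp_ineq1_le ((1 - s) * ln (x / (x + 1)))).
        pose proof (exp_ineq1_le (ln (x / (x + 1)))) as Hln. rewrite exp_ln in Hln by assumption.
        replace (x / (x + 1)) with (1 - / (x + 1)) in Hln at 2 by (field; lra). nra. }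
      apply (Rmult_le_compat_l P) in HB; lra. }
  apply Rmult_le_reg_r with (s - 1); [lra|].
  replace (s / (s - 1) * (s - 1)) with s by (field; lra).
  destruct N as [|N]; [simpl; lra|].
  pose proof (Hstep N). pose proof (Rpower_pos (INR (S N)) (1 - s)). lra.
Qed.

(** Serves to show that the harmonic series diverges; each step is [ln (1 + 1/x) <= 1/x]. *)
Lemma ln_le_harmonic (n : nat) : ln (INR (S n)) <= rsum (fun i => / INR (S i)) n.
Proof.
  induction n as [|n IH]; [simpl; rewrite ln_1; lra|].
  cbn [rsum]. rewrite (S_INR (S n)).
  assert (Hx : 0 < INR (S n)) by (apply lt_0_INR; lia).
  set (x := INR (S n)) in *.
  assert (Hi : 0 < / x) by now apply Rinv_0_lt_compat.
  replace (x + 1) with (x * (1 + / x)) by (field; lra).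
  rewrite ln_mult by lra.
  pose proof (exp_ineq1_le (ln (1 + / x))) as H. rewrite exp_ln in H by lra. lra.
Qed.

Lemma harmonic_bracket (y : R) : 0 <= y ->
  exists n, rsum (fun i => / INR (S i)) n <= y <= rsum (fun i => / INR (S i)) (S n).
Proof.
  intros Hy.
  assert (Hex : exists n, y < rsum (fun i => / INR (S i)) n).
  { destruct (INR_unbounded (exp y)) as [n Hn]. exists n.
    eapply Rlt_le_trans; [|apply ln_le_harmonic].
    rewrite <- (ln_exp y). apply ln_increasing; [apply exp_pos|]. rewrite S_INR; lra. }
  destruct Hex as [n Hn]. induction n as [|n IH]; [simpl in Hn; lra|].
  destruct (Rlt_dec y (rsum (fun i => / INR (S i)) n)) as [H|H]; [auto|].
  exists n. lra.
Qed.

(* Consecutive intervals of lengths eta/1, eta/2, ... fill a half-line, while the sum of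
   the s-th powers of their lengths is a multiple of eta^s. *)
Lemma hausdorff_null_gt1 (s : R) (E : R -> Prop) : 1 < s -> hausdorff_null s E.
Proof.
  intros Hs delta eps Hdelta Heps.
  set (Z := s / (s - 1)).
  assert (HZ : 0 < Z) by (apply Rdiv_lt_0_compat; lra).
  (* The diameters [2 eta / (n+1)] are then at most [delta], and [(2 eta)^s <= eps / Z] makes the
     total at most [eps]. *)
  set (eta := Rmin delta (Rpower (eps / Z) (/ s)) / 2).
  assert (Heta : 0 < eta).
  { unfold eta. apply Rdiv_lt_0_compat; [|lra]. apply Rmin_glb_lt; [lra|apply Rpower_pos]. }
  assert (Heta1 : 2 * eta <= delta) by (unfold eta; pose proof (Rmin_l delta (Rpower (eps / Z) (/ s))); lra).
  assert (Heta2 : 2 * eta <= Rpower (eps / Z) (/ s)) by (unfold eta; pose proof (Rmin_r delta (Rpower (eps / Z) (/ s))); lra).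
  set (H := rsum (fun i => / INR (S i))).
  (* Even indices fill the nonnegative half-line, odd ones its mirror image. *)
  exists (fun n x => let y := if Nat.even n then x else - x in
            eta * H (n / 2)%nat <= y <= eta * H (S (n / 2))).
  exists (fun n => 2 * eta / INR (S n)).
  assert (HS : forall n, 0 < INR (S n)) by (intros; apply lt_0_INR; lia).
  split; [|split; [|split]].
  - intros n. specialize (HS n). split; [apply Rle_mult_inv_pos; lra|].
    apply Rle_trans with (2 * eta); [|assumption].
    apply Rmult_le_reg_r with (INR (S n)); [assumption|].
    replace (2 * eta / INR (S n) * INR (S n)) with (2 * eta) by (field; lra).
    assert (1 <= INR (S n)) by (rewrite S_INR; pose proof (pos_INR n); lra). nra.
  - intros n x y. cbv zeta. intros Hx Hy.
    (* The length is [eta / (n/2 + 1)] with integer division, and [n + 1 <= 2 (n/2 + 1)]: hence the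
       factor 2 in the diameters. *)
    assert (Hd : eta * H (S (n / 2)) - eta * H (n / 2)%nat <= 2 * eta / INR (S n)).
    { unfold H; cbn [rsum]. rewrite Rmult_plus_distr_l.
      assert (Hle : INR (S n) <= 2 * INR (S (n / 2))).
      { change 2 with (INR 2). rewrite <- mult_INR. apply le_INR.
        pose proof (Nat.div_mod_eq n 2); pose proof (Nat.mod_upper_bound n 2). lia. }
      specialize (HS (n / 2)%nat) as Hm. specialize (HS n).
      assert (Hinv : / INR (S (n / 2)) <= 2 / INR (S n)).
      { apply Rmult_le_reg_r with (INR (S n) * INR (S (n / 2))); [nra|].
        replace (/ INR (S (n / 2)) * (INR (S n) * INR (S (n / 2)))) with (INR (S n)) by (field; lra).
        replace (2 / INR (S n) * (INR (S n) * INR (S (n / 2)))) with (2 * INR (S (n / 2))) by (field; lra).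
        exact Hle. }
      apply (Rmult_le_compat_l eta) in Hinv; [|lra].
      unfold Rdiv in *. lra. }
    destruct (Nat.even n); apply Rabs_le; lra.
  - intros x _. destruct (harmonic_bracket (Rabs x / eta)) as [n Hn].
    { apply Rle_mult_inv_pos; [apply Rabs_pos | assumption]. }
    assert (Hn' : eta * H n <= Rabs x <= eta * H (S n)).
    { unfold H. replace (Rabs x) with (eta * (Rabs x / eta)) by (field; lra).
      split; apply Rmult_le_compat_l; lra. }
    destruct (Rle_dec 0 x) as [Hx|Hx].
    + exists (2 * n)%nat. cbv zeta. rewrite Nat.even_even.
      replace (2 * n / 2)%nat with n by (apply (Nat.div_unique _ _ _ 0); lia).
      rewrite Rabs_pos_eq in Hn' by lra. exact Hn'.
    + exists (2 * n + 1)%nat. cbv zeta. rewrite Nat.even_odd.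
      replace ((2 * n + 1) / 2)%nat with n by (apply (Nat.div_unique _ _ _ 1); lia).
      rewrite Rabs_left in Hn' by lra. exact Hn'.
  - intros n. rewrite <- rsum_sum_f_R0.
    apply Rle_trans with (rsum (fun i => Rpower (2 * eta) s * Rpower (INR (S i)) (- s)) (S n)).
    + apply rsum_le; intros i _. right. specialize (HS i).
      assert (Hp : 0 < 2 * eta / INR (S i)) by (apply Rdiv_lt_0_compat; lra).
      unfold rpow. destruct (Rle_dec (2 * eta / INR (S i)) 0); [lra|].
      unfold Rdiv. rewrite <- Rpower_mult_distr; [|lra|now apply Rinv_0_lt_compat].
      f_equal. unfold Rpower. rewrite ln_Rinv by assumption. f_equal; ring.
    + rewrite rsum_scal.
      apply Rle_trans with (eps / Z * Z); [|right; field; lra].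
      apply Rmult_le_compat.
      * left; apply Rpower_pos.
      * apply rsum_nonneg; intros; left; apply Rpower_pos.
      * replace (eps / Z) with (Rpower (Rpower (eps / Z) (/ s)) s).
        2:{ rewrite Rpower_mult, Rinv_l, Rpower_1; [reflexivity| |lra].
            apply Rdiv_lt_0_compat; lra. }
        apply Rle_Rpower_l; lra.
      * apply sum_Rpower_gt1_le; lra.
Qed.

(** * The lower bound for the dimension *)

(** The exponential is the cube of [exp (L k / 3)], hence at least [(L k)^3 / 27], which exceeds
    [C k^2] once [k >= 27 C / L^3]. *)
Lemma square_le_exp (C L : R) : 0 < L ->
  exists K, forall k, (K <= k)%nat -> C * INR k ^ 2 <= exp (L * INR k).
Proof.
  intros HL. destruct (INR_unbounded (27 * C / L ^ 3)) as [K HK].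
  exists K. intros k Hk. apply le_INR in Hk.
  assert (HL3 : 0 < L ^ 3) by (apply pow_lt; assumption).
  assert (HC : 27 * C <= L ^ 3 * INR k).
  { apply Rle_trans with (L ^ 3 * (27 * C / L ^ 3)); [right; field; lra|].
    apply Rmult_le_compat_l; lra. }
  pose proof (pos_INR k) as Hk0. set (x := INR k) in *.
  replace (L * x) with (L * x / 3 + L * x / 3 + L * x / 3) by field.
  rewrite !exp_plus. pose proof (exp_ineq1_le (L * x / 3)) as He.
  assert (Hy : 0 <= L * x / 3) by nra.
  set (y := L * x / 3) in *.
  apply Rle_trans with (y * y * y).
  - unfold y. replace (L * x / 3 * (L * x / 3) * (L * x / 3)) with (L ^ 3 * x * x ^ 2 / 27) by field.
    assert (0 <= x ^ 2) by apply pow2_ge_0. nra.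
  - repeat apply Rmult_le_compat; try lra. nra.
Qed.

Lemma term_weight (a alpha beta : R) (q : nat) :
  term a alpha beta q = weight a alpha q * dnint (INR q * beta).
Proof. reflexivity. Qed.

(** It suffices to refute a cover of total [s]-size at most 1 with diameters at most [8^(-K0)]: the
    avoidance lemma yields a point [b] of the set that no covering set contains. *)
Lemma not_hausdorff_null_lt1 (a alpha s : R) : 0 < a < 1 -> badly_approximable alpha ->
  0 < s < 1 -> ~ hausdorff_null s (fun beta => liminf_pos (term a alpha beta)).
Proof.
  intros Ha Halpha Hs Hnull.
  destruct (weight_block_sum a alpha Ha Halpha) as [C [HC Hblock]].
  assert (Hln2 : 0 < ln 2) by (pose proof ln_lt_2; lra).
  assert (Hln8 : 0 < ln 8) by (rewrite <- ln_1; apply ln_increasing; lra).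
  (* [512 = 16 * 32] serves the rounding term, and [544 = 34 * 2 * 8] the balls, where
     [exp ((1-s) k ln 8) = 8^k / 8^(k s)]. *)
  destruct (square_le_exp 512 (ln 2) Hln2) as [K1 HK1].
  destruct (square_le_exp 544 ((1 - s) * ln 8)) as [K2 HK2]; [nra|].
  set (K0 := S (K1 + K2)).
  destruct (Hnull (/ 8 ^ K0) 1) as [U [d [Hd [Hdiam [Hcov Hsum]]]]];
    [apply Rinv_0_lt_compat, pow8_pos | lra |].
  (* A point of [U i], arbitrary if [U i] is empty; in the end only a set containing [b] matters. *)
  set (u := fun i => epsilon (inhabits 0) (U i)).
  (* Cover sets with [d i = 0] get pairwise distinct levels: infinitely many may occur. *)
  set (cls := fun i k => (K0 < k)%nat /\
     ((0 < d i /\ / 8 ^ k < d i <= 8 / 8 ^ k) \/ (d i = 0 /\ k = (K0 + 1 + i)%nat))).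
  (* Makes [c * C / k] equal to the admissible block sum [1 / (256 k)]. *)
  set (c := / (256 * C)).
  assert (Hc : 0 < c) by (apply Rinv_0_lt_compat; lra).
  set (delta := fun q => c * / weight a alpha q).
  destruct (avoid_fractions_and_balls delta K0 u cls) as [b [Hb [HQ HU]]].
  - unfold K0; lia.
  - intros q. unfold delta. apply Rmult_le_pos; [lra|].
    destruct (weight_nonneg a alpha q) as [Hw|Hw].
    + left; now apply Rinv_0_lt_compat.
    (* A zero weight does occur, at [q = 0]; there the convention [/ 0 = 0] applies. *)
    + rewrite <- Hw, Rinv_0. lra.
  - intros k Hk. unfold delta. rewrite rsum_scal.
    assert (0 < INR k) by (apply lt_0_INR; unfold K0 in Hk; lia).
    apply Rle_trans with (c * (C / INR k)).
    + apply Rmult_le_compat_l; [lra|]. apply Hblock. unfold K0 in Hk; lia.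
    + right. unfold c. field. lra.
  - intros k Hk.
    assert (Hk1 : 1 <= INR k) by (apply (le_INR 1); unfold K0 in Hk; lia).
    specialize (HK1 k ltac:(unfold K0 in Hk; lia)).
    replace (exp (ln 2 * INR k)) with (2 ^ k) in HK1
      by (rewrite <- Rpower_pow by lra; unfold Rpower; f_equal; ring).
    assert (H2k : 0 < 2 ^ k) by (apply pow_lt; lra).
    apply Rmult_le_reg_r with (2 ^ k * (32 * INR k)); [nra|].
    replace (16 / 2 ^ k * (2 ^ k * (32 * INR k))) with (512 * INR k) by (field; lra).
    replace (1 / (32 * INR k) * (2 ^ k * (32 * INR k))) with (2 ^ k) by (field; lra).
    nra.
  - intros k n Hk. pose proof (pow8_pos k) as Hpk.
    assert (Hk1 : 1 <= INR k) by now apply (le_INR 1).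
    assert (Hk2 : 0 < 8 * INR k ^ 2) by (simpl; nra).
    destruct (le_lt_dec k K0) as [Hle|Hlt].
    { rewrite cnt_empty by (unfold cls; intros v _ [Hv _]; lia).
      rewrite Rmult_0_r. apply Rle_mult_inv_pos; lra. }
    set (E := Rpower (8 ^ k) s).
    assert (HE1 : 1 <= E).
    { unfold E. rewrite <- (Rpower_O (8 ^ k)) by assumption.
      apply Rle_Rpower; [apply pow_R1_Rle|]; lra. }
    (* A set of positive diameter in class [k] has [(8^k d i)^s >= 1], so these number at most [E]
       times the total size 1; sets of diameter 0 add at most one per level. *)
    assert (Hcount : cnt (fun i => cls i k) n <= E + 1).
    { apply Rle_trans with (rsum (fun i => E * rpow (d i) s) n
                            + cnt (fun i => k = (K0 + 1 + i)%nat) n).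
      - unfold cnt. rewrite <- rsum_plus. apply rsum_le; intros i _.
        assert (Hr : 0 <= E * rpow (d i) s).
        { apply Rmult_le_pos; [lra|]. unfold rpow.
          destruct (Rle_dec (d i) 0); [lra|left; apply Rpower_pos]. }
        pose proof (ind_bound (k = (K0 + 1 + i)%nat)) as Hind.
        destruct (classic (cls i k)) as [Hi|Hi]; [|rewrite (ind_false _ Hi); lra].
        rewrite (ind_true _ Hi). destruct Hi as [_ [[Hi0 [Hi1 Hi2]]|[_ Hi]]].
        + assert (1 <= E * rpow (d i) s); [|lra].
          unfold rpow. destruct (Rle_dec (d i) 0); [lra|].
          unfold E. rewrite Rpower_mult_distr by assumption.
          rewrite <- (Rpower_O (8 ^ k * d i)) by nra.
          apply Rle_Rpower; [|lra].
          apply Rle_trans with (8 ^ k * / 8 ^ k); [right; field; lra|].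
          apply Rmult_le_compat_l; lra.
        + rewrite (ind_true _ Hi). lra.
      - apply Rplus_le_compat; [|apply cnt_subsingleton; intros; lia].
        rewrite rsum_scal. rewrite <- (Rmult_1_r E) at 2. apply Rmult_le_compat_l; [lra|].
        destruct n as [|n]; [simpl; lra|]. rewrite rsum_sum_f_R0. apply Hsum. }
    specialize (HK2 k ltac:(unfold K0 in Hlt; lia)).
    assert (H8 : 8 ^ k = E * exp ((1 - s) * ln 8 * INR k)).
    { unfold E. rewrite <- Rpower_pow by lra. rewrite Rpower_mult. unfold Rpower.
      rewrite <- exp_plus. f_equal. ring. }
    apply Rle_trans with (68 * E); [lra|].
    apply Rmult_le_reg_r with (8 * INR k ^ 2); [assumption|].
    replace (8 ^ k / (8 * INR k ^ 2) * (8 * INR k ^ 2)) with (8 ^ k) by (field; lra).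
    rewrite H8. apply (Rmult_le_compat_l E) in HK2; lra.
  - assert (HbE : liminf_pos (term a alpha b)).
    { exists c. split; [exact Hc|]. exists (2 ^ K0)%nat. intros q Hq.
      rewrite term_weight.
      assert (Hq1 : (1 <= q)%nat) by (pose proof (Nat.pow_nonzero 2 K0); lia).
      destruct (dnint_attained_nat (INR q * b)) as [p Hp].
      { apply Rmult_le_pos; [apply pos_INR|lra]. }
      specialize (HQ q p Hq). rewrite Hp in HQ. unfold delta in HQ.
      assert (Hw : 0 < weight a alpha q).
      { destruct Halpha as [c0 [Hc0 Hbad]]. specialize (Hbad q Hq1).
        assert (Hqp : 0 < INR q) by (apply lt_0_INR; lia).
        assert (Hdn : 0 < dnint (INR q * alpha)) by nra.
        unfold weight.
        repeat apply Rmult_lt_0_compat; try apply Rpower_pos; assumption. }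
      apply (Rmult_le_compat_l (weight a alpha q)) in HQ; [|lra].
      replace (weight a alpha q * (c * / weight a alpha q)) with c in HQ by (field; lra).
      exact HQ. }
    destruct (Hcov b HbE) as [i Hi].
    assert (Hui : U i (u i)) by (apply epsilon_spec; now exists b).
    specialize (Hdiam i b (u i) Hi Hui). destruct (Hd i) as [Hd0 Hd1].
    (* Both [b] and [u i] lie in [U i], so their distance is at most [d i]; a level of class [i]
       with [d i < 16 / 8^k] contradicts the avoidance of the ball. *)
    assert (Hk : exists k, cls i k /\ d i < 16 / 8 ^ k).
    { destruct Hd0 as [Hd0|Hd0].
      - destruct (geometric_scale (/ 8) (d i)) as [n Hn]; [lra| |].
        { split; [assumption|]. apply Rle_trans with (/ 8 ^ K0); [assumption|].
          rewrite <- Rinv_1. apply Rinv_le_contravar; [lra|]. apply pow_R1_Rle; lra. }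
        rewrite !pow_inv in Hn. pose proof (pow8_pos n) as Hpn.
        assert (H8n : 8 / 8 ^ S n = / 8 ^ n) by (simpl; field; lra).
        exists (S n). split; [split|].
        + apply Nat.nle_gt; intros Hle.
          assert (Hc8 : / 8 ^ K0 <= / 8 ^ S n).
          { apply Rinv_le_contravar; [apply pow8_pos|]. apply Rle_pow; [lra|exact Hle]. }
          lra.
        + left. rewrite H8n. lra.
        + replace (16 / 8 ^ S n) with (2 * (8 / 8 ^ S n)) by (unfold Rdiv; ring).
          rewrite H8n. assert (0 < / 8 ^ n) by now apply Rinv_0_lt_compat. lra.
      - exists (K0 + 1 + i)%nat. split; [split; [lia|right; auto]|].
        rewrite <- Hd0. apply Rdiv_lt_0_compat; [lra|apply pow8_pos]. }
    destruct Hk as [k [Hk Hdk]].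
    specialize (HU i k ltac:(destruct Hk; lia) Hk). lra.
Qed.

Theorem theorem3 (a alpha : R) (ha : 0 < a < 1)
  (halpha : badly_approximable alpha) :
  hausdorff_dim (fun beta : R => liminf_pos (term a alpha beta)) 1.
Proof.
  split.
  - intros s [Hs Hnull]. apply Rnot_lt_le; intros Hlt.
    apply (not_hausdorff_null_lt1 a alpha s ha halpha); [lra | exact Hnull].
  - intros b Hb. apply Rnot_lt_le; intros Hlt.
    (* The exponent [(1 + b) / 2] lies strictly between 1 and [b]. *)
    assert (H : b <= (1 + b) / 2); [|lra].
    apply Hb. split; [lra|]. apply hausdorff_null_gt1; lra.
Qed.
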